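(* For every integer $c>2$ with $Q(c)\in\{1,2,4,6,8,10,12\}$ one has $H(c)=0$.
   Context: For a positive integer $n$, the radical is $R(n)=\prod_{p\mid n}p$ (product over the distinct primes dividing $n$), with $R(1)=1$, and $Q(n)=n/R(n)$. An $abc$ triple is a triple of pairwise coprime positive integers $(a,b,c)$ with $a+b=c$ and $1\le a<b<c$; it is an $abc$ hit if moreover $R(abc)<c$. $H(c)$ denotes the number of $abc$ hits with third entry $c$. *)

(* Defs.v *)
(* Mathematical Components world. *)
From mathcomp Require Import all_boot.

Set Implicit Arguments.
Unset Strict Implicit.
Unset Printing Implicit Defensive.

Definition radical (n : nat) : nat := \prod_(p <- primes n) p.

(* The division is exact for n > 0: see radical_dvd. *)
Definition Q (n : nat) : nat := n %/ radical n.

Definition abc_triple (a b c : nat) : bool :=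
  [&& coprime a b, coprime a c, coprime b c, a + b == c, 1 <= a, a < b & b < c].

Definition abc_hit (a b c : nat) : bool :=
  abc_triple a b c && (radical (a * b * c) < c).

(* Ranging over pairs (a, b) below c loses nothing, since an abc triple has
   a < b < c: see abc_hit_lt. *)
Definition H (c : nat) : nat := #|[set t : 'I_c * 'I_c | abc_hit t.1 t.2 c]|.

Lemma radical_dvd (n : nat) : 0 < n -> radical n %| n.
Proof.
move=> n_gt0; rewrite {2}(prod_prime_decomp n_gt0) prime_decompE big_map /=.
rewrite /radical !big_seq; elim/big_ind2: _ => // [|p].
  by move=> x1 x2 y1 y2; apply: dvdn_mul.
by rewrite -logn_gt0 => lp; apply: dvdn_exp.
Qed.

Lemma abc_hit_lt (a b c : nat) : abc_hit a b c -> (a < c) && (b < c).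
Proof.
case/andP=> /and5P[_ _ _ _ /and3P[_ ab bc]] _.
by rewrite bc (ltn_trans ab bc).
Qed.

(* Main.v *)
(* Coprimality gives R(abc) = R(ab)R(c), so a hit means R(ab) < Q(c) <= 12.
   This forces Q(c) to be even and greater than 2, hence c even and ab odd.
   Two distinct odd primes have product at least 15, so ab is a power of a
   single prime p < Q(c); as a and b are coprime and a < b, a = 1 and b = p^k.
   Since Q(c) R(Q(c)) divides c = p^k + 1, the powers of p modulo
   Q(c) R(Q(c)) must reach -1; none of the finitely many cases allows this. *)
Require Import Defs.
From mathcomp Require Import all_boot.
From mathcomp Require Import zify.

Lemma radicalM (m n : nat) : 0 < m -> 0 < n -> coprime m n ->
  radical (m * n) = radical m * radical n.
Proof.
move=> m_gt0 n_gt0 co_mn; rewrite /radical -big_cat; apply: perm_big.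
apply: uniq_perm; first exact: primes_uniq.
  rewrite cat_uniq !primes_uniq /= andbT.
  by rewrite has_sym -coprime_has_primes // coprime_sym.
by move=> p; rewrite mem_cat primesM.
Qed.

Lemma radical_gt0 (n : nat) : 0 < radical n.
Proof.
rewrite /radical big_seq; apply: prodn_cond_gt0 => p.
by rewrite mem_primes => /andP[/prime_gt0].
Qed.

Lemma dvdn_radical (m n : nat) : 0 < n -> m %| n -> radical m %| radical n.
Proof.
move=> n_gt0 m_dvd_n.
have m_gt0 : 0 < m by apply: dvdn_gt0 m_dvd_n.
(* Split the product over [primes n] by membership in [primes m]: the factor inside is
   [radical m]. *)
rewrite {2}/radical (bigID (mem (primes m))) /= -big_filter.
rewrite (perm_big (primes m)) ?dvdn_mulr //.
apply: uniq_perm; rewrite ?filter_uniq ?primes_uniq // => p.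
rewrite mem_filter; apply: andb_idr; rewrite !mem_primes n_gt0.
by case/and3P=> -> _ /dvdn_trans ->.
Qed.

Lemma prime_dvd_radical (p n : nat) : 0 < n -> prime p -> p %| n ->
  p %| radical n.
Proof.
move=> n_gt0 p_pr /(dvdn_radical _ _ n_gt0).
by rewrite /radical primes_prime // big_seq1.
Qed.

Lemma Q_mul_radical (n : nat) : 0 < n -> Q n * radical n = n.
Proof. by move=> n_gt0; rewrite /Q divnK // radical_dvd. Qed.

(** As [Q n] divides [n], its radical divides [radical n], the cofactor of [Q n] in [n]. *)
Lemma Q_radical_Q_dvd (n : nat) : 0 < n -> Q n * radical (Q n) %| n.
Proof.
move=> n_gt0; rewrite -{3}(Q_mul_radical n n_gt0) dvdn_mul //.
by apply: dvdn_radical => //; rewrite -{2}(Q_mul_radical n n_gt0) dvdn_mulr.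
Qed.

Lemma expn_mod_mem (s : seq nat) (p m k : nat) :
  1 %% m \in s -> all (fun x => x * p %% m \in s) s -> p ^ k %% m \in s.
Proof.
move=> s1 /allP sp; elim: k => [|k IHk] //.
by rewrite expnSr -modnMml sp.
Qed.

(** Here [s] is an invariant set of residues: it contains 1, is stable under multiplication by [p]
    and avoids -1. *)
Lemma dvdn_succ_exp_false (s : seq nat) (p m k : nat) :
  1 %% m \in s -> all (fun x => (x * p %% m \in s) && (x.+1 %% m != 0)) s ->
  ~~ (m %| (p ^ k).+1).
Proof.
move=> s1; rewrite all_predI => /andP[sp /allP s0].
by rewrite /dvdn -addn1 -modnDml addn1 s0 // expn_mod_mem.
Qed.

Lemma QradQ_ndvd_succ_exp (q p k : nat) : q \in [:: 4; 6; 8; 10; 12] ->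
  prime p -> coprime p q -> p < q -> ~~ (q * radical q %| (p ^ k).+1).
Proof.
move=> q_in p_pr co_pq p_lt_q.
pose m := q * \prod_(r <- primes q) r.
(* The orders involved are at most 20, so this lists all powers of p mod m. *)
apply: (dvdn_succ_exp_false (traject (fun x => x * p %% m) 1 20)).
  rewrite /radical; move: q_in; rewrite !inE /m.
  by case/or4P=> [/eqP->|/eqP->|/eqP->|/orP[]/eqP->]; rewrite unlock.
rewrite /radical {}/m; move: q_in p_pr co_pq p_lt_q; rewrite !inE.
(* [unlock] makes the products compute, giving moduli 8, 36, 16, 100 and 72. Peeling off 12 values
   of [p] exhausts [p < q]; composite [p] and [p] dividing [q] contradict the hypotheses. *)
by case/or4P=> [/eqP->|/eqP->|/eqP->|/orP[]/eqP->]; rewrite unlock;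
  do 12?[case: p => [|p] //].
Qed.

Lemma mul_distinct_odd_ge15 (m n : nat) : 1 < m -> 1 < n -> odd m -> odd n ->
  m != n -> 15 <= m * n.
Proof.
wlog m_lt_n : m n / m < n => [hwlog|] m_gt1 n_gt1 m_odd n_odd m_neq_n.
  have /orP[lt_mn|lt_nm] : (m < n) || (n < m) by rewrite -neq_ltn.
    exact: hwlog.
  by rewrite mulnC hwlog // eq_sym.
have m_ge3 : 3 <= m by lia.
have n_ge5 : 5 <= n by lia.
exact: leq_mul m_ge3 n_ge5.
Qed.

Theorem proposition2 (c : nat) (hc : 2 < c)
    (hQ : Q c \in [:: 1; 2; 4; 6; 8; 10; 12]) : H c = 0.
Proof.
have c_gt0 : 0 < c by apply: leq_trans hc.
apply/eqP; rewrite cards_eq0 -subset0; apply/subsetP => -[i j].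
rewrite !inE /=; move: (nat_of_ord i) (nat_of_ord j) => a b.
case/andP=> /and5P[co_ab co_ac co_bc /eqP abc /and3P[a_gt0 a_lt_b _]] hit.
have b_gt1 : 1 < b by apply: leq_ltn_trans a_lt_b.
have ab_gt0 : 0 < a * b by rewrite muln_gt0 a_gt0 ltnW.
have co_abc : coprime (a * b) c by rewrite coprimeMl co_ac.
have rad_lt : radical (a * b) < Q c.
  (* Multiplying both sides by [radical c] turns the goal into [hit]. *)
  by rewrite -(ltn_pmul2r (radical_gt0 c)) -radicalM // Q_mul_radical.
have Qc_dvd : Q c %| c by rewrite -{2}(Q_mul_radical c c_gt0) dvdn_mulr.
have co_Q r : r %| a * b -> coprime r (Q c).
  by move=> r_dvd; apply: coprime_dvdl r_dvd (coprime_dvdr Qc_dvd co_abc).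
(* The prime is taken from [b], since [a] may be 1. *)
set p := pdiv b; have p_pr : prime p by apply: pdiv_prime.
have p_dvd_b : p %| b by apply: pdiv_dvd.
have p_dvd : p %| a * b by rewrite dvdn_mull.
have p_lt : p < Q c.
  apply: leq_ltn_trans rad_lt; apply: dvdn_leq; first exact: radical_gt0.
  exact: prime_dvd_radical.
have Q_in : Q c \in [:: 4; 6; 8; 10; 12].
  have := prime_gt1 p_pr; move: hQ p_lt.
  (* The values 1 and 2 leave no room for [1 < p < Q c]. *)
  by rewrite !inE => /orP[/eqP->|/orP[/eqP->|//]]; lia.
have Q_even : 2 %| Q c.
  by move: Q_in; rewrite !inE => /or4P[/eqP->|/eqP->|/eqP->|/orP[]/eqP->].
have Q_le : Q c <= 12.
  by move: Q_in; rewrite !inE => /or4P[/eqP->|/eqP->|/eqP->|/orP[]/eqP->].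
have odd_prime r : prime r -> r %| a * b -> odd r.
  move=> r_pr /co_Q/(coprime_dvdr Q_even); rewrite coprime_sym.
  by rewrite coprime2n.
have p_only r : prime r -> r %| a * b -> r = p.
  move=> r_pr r_dvd; apply/eqP/negPn/negP => r_neq_p.
  have co_rp : coprime r p by rewrite prime_coprime // dvdn_prime2.
  have : r * p <= radical (a * b).
    apply: dvdn_leq; first exact: radical_gt0.
    by rewrite Gauss_dvd // !prime_dvd_radical.
  (* A second prime [r] would give [15 <= r * p <= radical (a * b) < Q c <= 12]. *)
  have := mul_distinct_odd_ge15 r p (prime_gt1 r_pr) (prime_gt1 p_pr).
  move/(_ (odd_prime r r_pr r_dvd) (odd_prime p p_pr p_dvd) r_neq_p) => rp_ge.
  move/(leq_trans rp_ge)/leq_ltn_trans/(_ rad_lt).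
  by rewrite ltnNge (leq_trans Q_le).
have a1 : a = 1.
  apply/eqP/negPn/negP => a_neq1.
  have a_gt1 : 1 < a by rewrite ltn_neqAle eq_sym a_neq1.
  (* A prime factor of [a] would be [p], hence common to [a] and [b]. *)
  have r_pr := pdiv_prime a_gt1; have r_dvd := pdiv_dvd a.
  have rp := p_only _ r_pr (dvdn_mulr b r_dvd).
  have : p %| gcdn a b by rewrite dvdn_gcd p_dvd_b -rp r_dvd.
  by rewrite (eqP co_ab) dvdn1 => /eqP p1; rewrite p1 in p_pr.
have [k b_eq] : exists k, b = p ^ k.
  have /p_natP[k ->] : p.-nat b; last by exists k.
  apply/pnatP; first exact: ltnW.
  by move=> r r_pr r_dvd; rewrite inE /= (p_only r) ?dvdn_mull.
have /negP := QradQ_ndvd_succ_exp (Q c) p k Q_in p_pr (co_Q p p_dvd) p_lt.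
by case; rewrite -b_eq -[b.+1]add1n -a1 abc; apply: Q_radical_Q_dvd.
Qed.
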